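(* Let $K$ be a field with $\mathrm{char}(K)\neq 2,3$, $k\in K^*$, $E_k: y^2=x^3+\frac{k}{4}$, $L=K\big(\sqrt{x^3+k/4}\big)_{x\in K}\subseteq\overline{K}$, and let $\psi_k$ be the degree-3 endomorphism of $E_k$ defined by $\psi_k(P)=\mathcal{O}$ for $P\in\{\mathcal{O},\pm T_k\}$, $T_k=(0,\sqrt{k}/2)$, and $\psi_k(x,y)=\left(-\frac{x^3+k}{3x^2},-y\frac{x^3-2k}{3\sqrt{-3}x^3}\right)$ otherwise (for fixed square roots $\sqrt{-3},\sqrt k\in\overline K$). Then every finite connected component (if any) of the functional graph of $\psi_k$ on $E_k(L)$ consists of a cycle of periodic elements, each of them being the root of a complete ternary tree isomorphic to the preperiodic tree $\tau_{\mathcal{O}}$.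
   Context: The functional graph of $\psi_k$ is the directed graph with edges $P\to\psi_k(P)$. A point $P$ is periodic if $\psi_k^{(n)}(P)=P$ for some $n\geq1$ ($\psi_k^{(n)}$ is the $n$-th iterate). Connected components are the equivalence classes of the relation $P\sim Q$ iff $\psi_k^{(n)}(P)=\psi_k^{(m)}(Q)$ for some $n,m\geq0$. For a periodic $P$, the preperiodic tree $\tau_P$ is the arborescence on the points $\{Q \text{ non-periodic}: \psi_k^{(n)}(Q)=P \text{ for some } n\}\cup\{P\}$, with edges given by $\psi_k$ except the edge leaving the root $P$. A ternary tree is an arborescence in which each node has at most 3 children; it is full if each node has 0 or 3 children; a full ternary tree is complete if all leaves have the same depth.
   Formalization: As the root's third preimage is periodic and not in its tree, ''complete ternary'' is taken to mean: the root has exactly 2 children, other nodes 0 or 3, leaves at equal depth. The nodes of τ_P besides P are the non-periodic points whose first periodic iterate is P. *)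

(* Defs.v *)
From HB Require Import structures.
From mathcomp Require Import all_boot all_order all_algebra.
From mathcomp Require Import mathcomp_extra boolp classical_sets functions.
From mathcomp Require Import cardinality.

Set Implicit Arguments.
Unset Strict Implicit.
Unset Printing Implicit Defensive.

Import GRing.Theory.

Local Open Scope classical_set_scope.
Local Open Scope card_scope.
Local Open Scope ring_scope.

Section Trees.
Variable T : Type.

(* Arcs point towards the root. *)
Record rooted_digraph := RootedDigraph {
  nodes : set T;
  arc : T -> T -> Prop;
  root : T
}.

Implicit Types G : rooted_digraph.

(* [s] lists the nodes visited after [u]; the walk from [u] ends at [v]. *)
Fixpoint walk G (u : T) (s : seq T) (v : T) : Prop :=
  if s is w :: s' then arc G u w /\ walk G w s' v else u = v.

Definition arborescence G : Prop :=
  [/\ nodes G (root G),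
      (forall u v, arc G u v -> nodes G u /\ nodes G v) &
      (forall v, nodes G v -> exists! s : seq T, walk G v s (root G))].

Definition children G (v : T) : set T := [set u | arc G u v].

Definition leaf G (v : T) : Prop := nodes G v /\ children G v = set0.

Definition has_depth G (v : T) (n : nat) : Prop :=
  exists s : seq T, walk G v s (root G) /\ size s = n.

Definition ternary_tree G : Prop :=
  arborescence G /\ forall v, nodes G v -> children G v #<= `I_3.

(* Full ternary tree whose root lies on a cycle of the ambient functional
   graph.  One of the three preimages of the root is its predecessor on the
   cycle, which is not a node of the tree: inside the tree the root therefore
   has exactly two children, and every other node has 0 or 3 children. *)
Definition full_ternary_on_cycle G : Prop :=
  [/\ ternary_tree G,
      children G (root G) #= `I_2 &
      forall v, nodes G v -> v <> root G ->
        children G v = set0 \/ children G v #= `I_3].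

Definition complete_ternary_on_cycle G : Prop :=
  full_ternary_on_cycle G /\
  forall (u v : T) (m n : nat), leaf G u -> leaf G v ->
    has_depth G u m -> has_depth G v n -> m = n.

Definition tree_isomorphic G H : Prop :=
  exists phi : T -> T,
    [/\ set_bij (nodes G) (nodes H) phi,
        phi (root G) = root H &
        forall u v, nodes G u -> nodes G v ->
          (arc G u v <-> arc H (phi u) (phi v))].

End Trees.

(* Functional graph of [f] on a set [V], assumed stable under [f]. *)
Section FunctionalGraph.
Variables (T : Type) (f : T -> T) (V : set T).

Definition periodic (P : T) : Prop := exists n, (0 < n)%N /\ iter n f P = P.

Definition connected (P Q : T) : Prop := exists n m, iter n f P = iter m f Q.

Definition component (C : set T) : Prop :=
  exists P, V P /\ C = [set Q | V Q /\ connected P Q].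

Definition is_cycle (A : set T) : Prop :=
  exists (P : T) (n : nat),
    [/\ (0 < n)%N, iter n f P = P & set_bij `I_n A (fun i => iter i f P)].

(* A non-periodic point [Q] belongs to the tree of the first periodic point on
   its orbit only; it also reaches the other points of the cycle, but not
   within the non-periodic points. *)
Definition preperiodic_nodes (P : T) : set T :=
  P |` [set Q | [/\ V Q, ~ periodic Q &
                 exists n, iter n f Q = P /\
                   forall i, (i < n)%N -> ~ periodic (iter i f Q)]].

Definition preperiodic_tree (P : T) : rooted_digraph T :=
  RootedDigraph (preperiodic_nodes P)
    (fun u v => [/\ preperiodic_nodes P u, preperiodic_nodes P v,
                    u <> P & f u = v])
    P.

End FunctionalGraph.

Section Curve.
Variables (K : fieldType) (Kbar : closedFieldType).
Variables (iota : {rmorphism K -> Kbar}) (k : K).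

(* [iota] exhibits [Kbar] as an algebraic closure of [K]. *)
Definition is_algebraic_closure : Prop := forall z, algebraicOver iota z.

Definition ec_point : Type := option (Kbar * Kbar).

Notation infty := (None : ec_point).
Notation affine x y := (Some (x, y) : ec_point).

Definition curve : set ec_point :=
  [set P | if P is Some (x, y) then y ^+ 2 = x ^+ 3 + iota k / 4 else True].

Definition subfield_closed (S : set Kbar) : Prop := divring_closed (mem S).

(* K(sqrt(x^3 + k/4))_{x in K}; adjoining one square root or both is the
   same. *)
Definition fieldL : set Kbar :=
  smallest subfield_closed
    (range iota `|` [set z | exists x : K, z ^+ 2 = iota (x ^+ 3 + k / 4)]).

Definition curveL : set ec_point :=
  [set P | curve P /\
           if P is Some (x, y) then fieldL x /\ fieldL y else True].

(* [s3] and [sk] are the chosen square roots of -3 and k. *)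
Definition psi (s3 sk : Kbar) (P : ec_point) : ec_point :=
  if P is Some (x, y) then
    if P \in [:: affine 0 (sk / 2); affine 0 (- (sk / 2))] then infty
    else affine (- ((x ^+ 3 + iota k) / (3 * x ^+ 2)))
                (- y * ((x ^+ 3 - 2 * iota k) / (3 * s3 * x ^+ 3)))
  else infty.

End Curve.

(* Main.v *)
(* Write P * Q for the third point of the cubic on the line through P and Q, so
   that P * Q = - P - Q.  This operation is commutative and satisfies
   P * (P * Q) = Q, and psi_k, which maps lines to lines, is an endomorphism for
   it.  These identities suffice: associativity of the group law is not needed.

   Let P be periodic and let R_n be the point of its cycle with
   psi^n(R_n) = P.  Then Q |-> R_n - Q identifies the points at height n over P
   with those at height n over O, whence tau_P ~ tau_O.  Nonempty fibres are
   translates of ker psi = {O, T, - T}, hence have three elements.  If some w is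
   at height m + 1 over O, then psi^m(w) generates ker psi; so every x at height
   m differs from psi(w) or - psi(w) by an element killed by psi^(m-1), and by
   induction x is in the image of psi.  Hence all leaves have the same depth. *)
Require Import Defs.
From mathcomp Require Import all_boot all_order all_algebra.
From mathcomp Require Import mathcomp_extra boolp classical_sets functions.
From mathcomp Require Import cardinality.
From mathcomp Require Import ring.

Set Implicit Arguments.
Unset Strict Implicit.
Unset Printing Implicit Defensive.

Import GRing.Theory.

Local Open Scope classical_set_scope.

(** * Sets with two or three elements *)

Lemma card_eq_set2 (T : Type) (a b : T) : a <> b -> ([set a; b] #= `I_2)%card.
Proof.
move=> ab; pose g i := if i is 0 then a else b.
have -> : [set a; b] = g @` `I_2.
  apply/seteqP; split=> [x [->|->]|x [[|[|//]] _ <-]].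
  - by exists 0.
  - by exists 1.
  - by left.
  - by right.
apply: inj_card_eq => i j /set_mem/= + /set_mem/=.
by case: i => [|[|i]] // _; case: j => [|[|j]] // _ /= e; case: ab.
Qed.

Lemma card_eq_set3 (T : Type) (a b c : T) :
  a <> b -> a <> c -> b <> c -> ([set a; b; c] #= `I_3)%card.
Proof.
move=> ab ac bc; pose g i := match i with 0 => a | 1 => b | _ => c end.
have -> : [set a; b; c] = g @` `I_3.
  apply/seteqP; split=> [x [[->|->]|->]|x [[|[|[|//]]] _ <-]].
  - by exists 0.
  - by exists 1.
  - by exists 2.
  - by left; left.
  - by left; right.
  - by right.
apply: inj_card_eq => i j /set_mem/= + /set_mem/=.
case: i => [|[|[|i]]] // _; case: j => [|[|[|j]]] // _ /= e;
  solve [by case: ab | by case: ac | by case: bc].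
Qed.

(** * Functional graphs: cycles, components and preperiodic trees *)

Section FunctionalGraphTheory.
Variables (T : Type) (f : T -> T) (V : set T).
Implicit Types (P Q : T) (C : set T).

Lemma iter_period p n P : iter p f P = P -> iter (n * p) f P = P.
Proof. by move=> pP; rewrite iterM iter_fix. Qed.

Lemma periodic_iter n Q : periodic f Q -> periodic f (iter n f Q).
Proof.
by move=> [p [p0 pQ]]; exists p; split=> //; rewrite -iterD addnC iterD pQ.
Qed.

(** With periods [p] and [q], both points return to themselves after [q * p] steps, and their orbits
    agree from the first step on. *)
Lemma periodic_inj P Q :
  periodic f P -> periodic f Q -> f P = f Q -> P = Q.
Proof.
move=> [p [p0 pP]] [q [q0 qQ]] fPQ.
rewrite -(iter_period q pP) -(iter_period p qQ) (mulnC p).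
by rewrite -(prednK (_ : 0 < q * p)%N) ?muln_gt0 ?p0 ?q0 // !iterSr fPQ.
Qed.

Lemma connected_periodic P Q :
  connected f P Q -> periodic f Q -> exists n, iter n f P = Q.
Proof.
(* From [f^m(Q)], another [m (q - 1)] steps complete [m] turns of the cycle. *)
move=> [n [m PQ]] [q [q0 qQ]]; exists (m * q.-1 + n).
by rewrite iterD PQ -iterD -mulnSr prednK // iter_period.
Qed.

Lemma connected_sym P Q : connected f P Q -> connected f Q P.
Proof. by move=> [n [m PQ]]; exists m, n. Qed.

Lemma connected_trans Q P P' :
  connected f P Q -> connected f Q P' -> connected f P P'.
Proof.
move=> [n [m PQ]] [n' [m' QP']]; exists (n' + n), (m + m').
by rewrite iterD PQ -iterD addnC iterD QP' -iterD.
Qed.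

Lemma connected_iter n P : connected f P (iter n f P).
Proof. by exists n, 0. Qed.

(* [Q] lies at height [n] in the preperiodic tree rooted at [P]. *)
Definition level P n Q :=
  [/\ V Q, iter n f Q = P & forall i, (i < n)%N -> ~ periodic f (iter i f Q)].

(** The height is the first time at which the orbit meets a periodic point. *)
Lemma level_uniq {P P' n n' Q} : periodic f P -> periodic f P' ->
  level P n Q -> level P' n' Q -> n = n' /\ P = P'.
Proof.
move=> pP pP' [_ nQ npn] [_ n'Q npn'].
suff nn' : n = n' by split=> //; rewrite -nQ -n'Q nn'.
case: (ltngtP n n') => // [/npn'|/npn]; first by rewrite nQ.
by rewrite n'Q.
Qed.

Lemma levelS P n Q : level P n.+1 Q -> (V (f Q)) -> level P n (f Q).
Proof.
move=> [_ nQ np] VfQ; split=> //; first by rewrite -iterSr.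
by move=> i lin; rewrite -iterSr; apply: np.
Qed.

Lemma preperiodic_nodesE P Q :
  V P -> preperiodic_nodes f V P Q <-> exists n, level P n Q.
Proof.
move=> VP; split.
  case=> [->|[VQ _ [n [nQ np]]]]; first by exists 0; split.
  by exists n; split.
move=> [[|n] [VQ nQ np]]; first by left.
by right; split=> //; [exact: (np 0)|exists n.+1].
Qed.

Hypothesis Vf : forall P, V P -> V (f P).

Lemma iter_stable n P : V P -> V (iter n f P).
Proof. by move=> VP; elim: n => //= n; apply: Vf. Qed.

Lemma component_connected {C} P : component f V C -> C P ->
  V P /\ C = [set Q | V Q /\ connected f P Q].
Proof.
move=> [P0 [VP0 ->]] [VP P0P]; split=> //; apply/seteqP; split=> Q [VQ cQ].
  by split=> //; apply: connected_trans cQ; apply: connected_sym.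
by split=> //; apply: connected_trans cQ.
Qed.

(** Otherwise [n |-> f^n(P)] is injective, and [C] contains a copy of the natural numbers. *)
Lemma finite_orbit_periodic C P : finite_set C ->
  (forall n, C (iter n f P)) -> exists n, periodic f (iter n f P).
Proof.
move=> finC CP; apply: contrapT => np.
have inj : injective (fun n => iter n f P).
  suff lt_neq m n : (m < n)%N -> iter m f P <> iter n f P.
    move=> m n; case: (ltngtP m n) => // [/lt_neq //|/lt_neq ne e].
    by case: ne.
  move=> mn e; apply: np; exists m, (n - m); rewrite subn_gt0; split=> //.
  by rewrite -iterD subnK // ltnW.
apply: (infiniteP _).2 _ finC.
have inj' : {in [set: nat] &, injective (fun n => iter n f P)} := in2W inj.
have /card_eqPle[_ le] := inj_card_eq inj'.
by apply: card_le_trans le _; apply: subset_card_le => _ [n _ <-].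
Qed.

Lemma finite_component_periodic C : component f V C -> finite_set C ->
  exists P, C P /\ periodic f P.
Proof.
move=> cC finC; have [P0 [VP0 CE]] := cC.
have CP n : C (iter n f P0).
  by rewrite CE; split; [exact: iter_stable|exact: connected_iter].
by have [n pn] := finite_orbit_periodic finC CP; exists (iter n f P0).
Qed.

Lemma component_cycle C : component f V C -> finite_set C ->
  is_cycle f (C `&` periodic f).
Proof.
move=> cC /(finite_component_periodic cC)[P [CP pP]].
have [VP CE] := component_connected cC CP.
have ex : exists n, (0 < n)%N && `[< iter n f P = P >].
  by have [n [n0 nP]] := pP; exists n; rewrite n0; apply/asboolP.
have [n /andP[n0 /asboolP nP] nmin] := ex_minnP ex.
exists P, n; split=> //; split.
- move=> i _; split; last exact: periodic_iter.
  by rewrite CE; split; [exact: iter_stable|exact: connected_iter].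
- suff lt_neq i j : (i < j)%N -> (j < n)%N -> iter i f P <> iter j f P.
    move=> i j /set_mem/= ilt /set_mem/= jlt.
    case: (ltngtP i j) => // [/lt_neq/(_ jlt)//|/lt_neq/(_ ilt) ne e].
    by case: ne.
  (* If [f^i(P) = f^j(P)], then [n - j] further steps give [f^(n - j + i)(P) = f^n(P) = P], against
     the minimality of [n]. *)
  move=> ij jn e; have : (n <= n - j + i)%N.
    apply: nmin; rewrite addn_gt0 subn_gt0 jn; apply/asboolP.
    by rewrite iterD e -iterD subnK // ltnW.
  by rewrite leqNgt -[X in (_ < X)%N](subnK (ltnW jn)) ltn_add2l ij.
- move=> Q [+ pQ]; rewrite CE => -[VQ cQ].
  have [m mP] := connected_periodic cQ pQ.
  exists (m %% n); first by rewrite /= ltn_mod.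
  by rewrite -mP {2}(divn_eq m n) addnC iterD iter_period.
Qed.

Lemma component_cover C : component f V C -> finite_set C ->
  C = \bigcup_(P in C `&` periodic f) preperiodic_nodes f V P.
Proof.
move=> cC /(finite_component_periodic cC)[P [CP pP]].
have [VP CE] := component_connected cC CP.
apply/seteqP; split=> Q.
  rewrite {1}CE => -[VQ PQ].
  (* The least such [n] is the time at which [Q] enters the cycle; the point of entry is the root of
     its tree. *)
  have ex : exists n, `[< periodic f (iter n f Q) >].
    have [n nQ] := connected_periodic (connected_sym PQ) pP.
    by exists n; rewrite nQ; apply/asboolP.
  have [n /asboolP pn nmin] := ex_minnP ex.
  exists (iter n f Q).
    split=> //; rewrite CE; split; first exact: iter_stable.
    exact: connected_trans PQ (connected_iter _ _).
  apply/preperiodic_nodesE; first exact: iter_stable.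
  exists n; split=> // i lin pi.
  by have := nmin i; rewrite leqNgt lin => /(_ (asboolT pi)).
move=> [P' [CP' pP']].
have [VP' CE'] := component_connected cC CP'.
move=> /(preperiodic_nodesE _ VP')[n [VQ nQ _]].
by rewrite CE'; split=> //; exists 0, n.
Qed.

Lemma preperiodic_trees_disjoint C : C `<=` V ->
  trivIset (C `&` periodic f) (preperiodic_nodes f V).
Proof.
move=> CV P P' [/CV VP pP] [/CV VP' pP'] [Q []].
move=> /(preperiodic_nodesE _ VP)[n nQ] /(preperiodic_nodesE _ VP')[n' n'Q].
by have [] := level_uniq pP pP' nQ n'Q.
Qed.

Lemma preperiodic_walk P n Q : V P -> periodic f P -> level P n Q ->
  exists s, walk (preperiodic_tree f V P) Q s P /\ size s = n.
Proof.
move=> VP pP; elim: n Q => [|n IH] Q lQ.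
  by have [_ /= ->] := lQ; exists [::].
have [VQ _ np] := lQ; have lfQ := levelS lQ (Vf VQ).
have [s [ws <-]] := IH _ lfQ.
exists (f Q :: s); split=> //=; split=> //; split=> //.
- by apply/preperiodic_nodesE => //; exists n.+1.
- by apply/preperiodic_nodesE => //; exists n.
- by move=> QP; apply: (np 0) => //=; rewrite QP.
Qed.

(** The only arc leaving a node [u] other than the root goes to [f u], and no arc leaves the
    root. *)
Lemma preperiodic_walk_uniq P Q s s' :
  walk (preperiodic_tree f V P) Q s P ->
  walk (preperiodic_tree f V P) Q s' P -> s = s'.
Proof.
elim: s s' Q => [|w s IH] [|w' s'] Q //=.
- by move=> -> [[]].
- by move=> + QP; rewrite QP => -[[]].
- by move=> [[_ _ _ <-] ws] [[_ _ _ <-] ws']; rewrite (IH _ _ ws ws').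
Qed.

Lemma preperiodic_depth P n m Q : V P -> periodic f P -> level P n Q ->
  has_depth (preperiodic_tree f V P) Q m -> m = n.
Proof.
move=> VP pP /(preperiodic_walk VP pP)[s [ws <-]] [s' [ws' <-]].
by rewrite (preperiodic_walk_uniq ws ws').
Qed.

Lemma preperiodic_arborescence P : V P -> periodic f P ->
  arborescence (preperiodic_tree f V P).
Proof.
move=> VP pP; split=> [|u v []//|Q /(preperiodic_nodesE _ VP)[n lQ]].
  by left.
have [s [ws _]] := preperiodic_walk VP pP lQ.
by exists s; split=> // s' ws'; apply: preperiodic_walk_uniq ws ws'.
Qed.

End FunctionalGraphTheory.

(** * Endomorphisms with a kernel of three elements *)

Section TotallySymmetricQuasigroup.
Variables (T : Type) (f : T -> T) (V : set T) (op : T -> T -> T) (O t : T).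
Hypotheses (Vf : forall x, V x -> V (f x))
  (Vop : forall x y, V x -> V y -> V (op x y))
  (opC : forall x y, V x -> V y -> op x y = op y x)
  (opK : forall x y, V x -> V y -> op x (op x y) = y)
  (fop : forall x y, V x -> V y -> f (op x y) = op (f x) (f y))
  (VO : V O) (opOO : op O O = O) (fO : f O = O)
  (Vt : V t) (ft : f t = O) (tO : t <> O) (NtNt : op O t <> t)
  (kerf : forall x, V x -> f x = O -> [\/ x = O, x = t | x = op O t]).

(* In terms of the group law, [op x y] is [- x - y], so that this is [r - x]. *)
Let sub r x := op (op O r) x.

Let VN r : V r -> V (op O r). Proof. exact: Vop. Qed.

Let Vsub r x : V r -> V x -> V (sub r x).
Proof. by move=> Vr Vx; apply: Vop => //; apply: VN. Qed.

Let subK r x : V r -> V x -> sub r (sub r x) = x.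
Proof. by move=> Vr Vx; apply: opK => //; apply: VN. Qed.

Let subxx r : V r -> sub r r = O.
Proof.
by move=> Vr; rewrite /sub opC ?(opC VO) //; [apply: opK|apply: Vop].
Qed.

Let sub0 r : V r -> sub r O = r.
Proof. by move=> Vr; rewrite /sub opC ?opK //; apply: VN. Qed.

Let subO x : sub O x = op O x. Proof. by rewrite /sub opOO. Qed.

Let sub_inj r x y : V r -> V x -> V y -> sub r x = sub r y -> x = y.
Proof. by move=> Vr Vx Vy e; rewrite -(subK Vr Vx) e subK. Qed.

Let fsub r x : V r -> V x -> f (sub r x) = sub (f r) (f x).
Proof. by move=> Vr Vx; rewrite /sub !fop ?fO //; apply: VN. Qed.

Let iter_sub i r x : V r -> V x ->
  iter i f (sub r x) = sub (iter i f r) (iter i f x).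
Proof.
move=> Vr Vx; elim: i => //= i ->.
by rewrite fsub //; apply: iter_stable.
Qed.

Let fNt : f (op O t) = O. Proof. by rewrite fop // fO ft. Qed.

Let periodicO : periodic f O. Proof. by exists 1. Qed.

(** The fibre through [q] consists of the elements [q - y] with [y] in the kernel. *)
Lemma fibre_card3 q : V q -> ([set x | V x /\ f x = f q] #= `I_3)%card.
Proof.
move=> Vq.
have -> : [set x | V x /\ f x = f q] = [set q; sub q t; sub q (op O t)].
  apply/seteqP; split=> [x [Vx fx]|x [[->|->]|->]].
  - have fq : f (sub q x) = O by rewrite fsub // fx subxx //; apply: Vf.
    rewrite -(subK Vq Vx).
    case: (kerf (Vsub Vq Vx) fq) => ->; last by right.
      by left; left; rewrite sub0.
    by left; right.
  - by [].
  - by split; [exact: Vsub|rewrite fsub // ft sub0 //; apply: Vf].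
  - by split; [apply: Vsub => //; apply: VN|
               rewrite fsub ?fNt ?sub0 //; [apply: Vf|apply: VN]].
apply: card_eq_set3 => e.
- by apply: tO; apply: (@sub_inj q) => //; rewrite -e sub0.
- have NtO : op O t = O.
    by apply: (@sub_inj q) => //; [exact: VN|rewrite -e sub0].
  by apply: tO; rewrite -(opK VO Vt) NtO.
- by apply: NtNt; apply: (@sub_inj q) => //; exact: VN.
Qed.

(* If some [w] has order exactly [f^(m+1)], then every element killed by [f^m]
   is divisible by [f]: this is where cyclicity of the kernel enters. *)
Lemma torsion_divisible m w : V w -> iter m.+1 f w = O -> iter m f w <> O ->
  forall x, V x -> iter m f x = O -> exists2 z, V z & f z = x.
Proof.
elim: m w => [|m IH] w Vw wO wN0 x Vx xO; first by exists O => //; rewrite fO.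
have IHw := IH _ (Vf Vw).
have [x0|xN0] := pselect (iter m f x = O).
  by apply: IHw; rewrite // -iterSr.
(* Both sides are nonzero elements of the kernel, hence [t] or [- t]; they agree after replacing [w]
   by [- w] if necessary. *)
wlog eqwx : w Vw wO wN0 {IHw} / iter m.+1 f w = iter m f x.
  move=> wlog; have Vmw := iter_stable Vf m.+1 Vw.
  have Vmx := iter_stable Vf m Vx.
  have iterN i : iter i f (op O w) = op O (iter i f w).
    by rewrite -subO iter_sub // (iter_fix i fO) subO.
  have [e|ne] := pselect (iter m.+1 f w = iter m f x); first exact: (wlog w).
  have wN : iter m.+1 f (op O w) = iter m f x.
    rewrite iterN.
    have [|wt|wt] := kerf Vmw wO; first by [].
      have [|xt|xt] := kerf Vmx xO; first by [].
        by case: ne; rewrite wt xt.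
      by rewrite wt xt.
    have [|xt|xt] := kerf Vmx xO; first by [].
      by rewrite wt xt opK.
    by case: ne; rewrite wt xt.
  apply: (wlog (op O w)) => //; first exact: VN.
  - by rewrite iterN wO.
  - by rewrite wN.
have Vfw := Vf Vw.
(* Now [f w - x] is killed by [f^m], so it is some [f z] by induction, and [x = f (w - z)]. *)
have [z Vz fz] : exists2 z, V z & f z = sub (f w) x.
  apply: IH (Vfw) _ _ _ (Vsub Vfw Vx) _; rewrite -?iterSr //.
  by rewrite iter_sub // -iterSr eqwx subxx //; apply: iter_stable.
by exists (sub w z); [exact: Vsub|rewrite fsub // fz subK].
Qed.

Lemma periodic_backward_orbit P : V P -> periodic f P ->
  exists R : nat -> T,
    R 0 = P /\ forall n, [/\ V (R n), periodic f (R n) & f (R n.+1) = R n].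
Proof.
move=> VP pP; have [p [p0 pPP]] := pP.
(* On a cycle of length dividing [p], one step backward amounts to [p - 1] steps forward. *)
exists (fun n => iter (n * p.-1) f P); split=> // n; split.
- exact: iter_stable.
- exact: periodic_iter.
- by rewrite -iterS mulSn -addSn prednK // addnC iterD pPP.
Qed.

(** By [periodic_inj], [S] is the only periodic preimage of [P]. If some earlier iterate of [Q] were
    periodic, so would be [f^m(Q)], which would then equal [S]. *)
Let level_intro P S m Q : periodic f S -> f S = P ->
  V Q -> iter m.+1 f Q = P -> iter m f Q <> S -> level f V P m.+1 Q.
Proof.
move=> pS fS VQ mQ neq; split=> // i; rewrite ltnS => lim pi.
apply: neq; apply: (@periodic_inj _ f) => //; last by rewrite fS.
by rewrite -(subnK lim) iterD; apply: periodic_iter.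
Qed.

(** * The tree at a periodic point compared with the tree at [O] *)

Section BackwardOrbit.
Variables (P : T) (R : nat -> T).
Hypotheses (R0 : R 0 = P) (VR : forall n, V (R n))
  (pR : forall n, periodic f (R n)) (fR : forall n, f (R n.+1) = R n).

Let VP : V P. Proof. by rewrite -R0. Qed.
Let pP : periodic f P. Proof. by rewrite -R0. Qed.

Let iter_backward i n : iter i f (R (i + n)) = R n.
Proof. by elim: i => // i IH; rewrite addSn iterSr fR. Qed.

Let iter_backward0 n : iter n f (R n) = P.
Proof. by rewrite -{2}(addn0 n) iter_backward. Qed.

Let iter_backward1 n : iter n f (R n.+1) = R 1.
Proof. by rewrite -addn1 iter_backward. Qed.

(** [f^n] sends [R n - Q] to [P - P = O]. For [n > 0], [f^(n-1)] sends it to [R 1 - f^(n-1)(Q)],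
    which is not [O] because [R 1] is periodic and [f^(n-1)(Q)] is not. *)
Lemma level_sub n Q : level f V P n Q -> level f V O n (sub (R n) Q).
Proof.
move=> [VQ nQ np]; case: n => [|n] in nQ np *.
  by split=> //; [exact: Vsub|rewrite R0 -nQ /= subxx].
apply: (level_intro periodicO fO); first exact: Vsub.
- by rewrite iter_sub // nQ iter_backward0 subxx.
- rewrite iter_sub // iter_backward1 => e; apply: (np n) => //.
  suff -> : iter n f Q = R 1 by [].
  apply: (@sub_inj (R 1)) => //; first exact: iter_stable.
  by rewrite e subxx.
Qed.

Lemma sub_level n Q : level f V O n Q -> level f V P n (sub (R n) Q).
Proof.
move=> [VQ nQ np]; case: n => [|n] in nQ np *.
  by split=> //; [exact: Vsub|move: nQ => /= ->; rewrite R0 sub0].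
apply: (@level_intro _ (R 1)) => //; first by rewrite fR.
- exact: Vsub.
- by rewrite iter_sub // nQ iter_backward0 sub0.
- rewrite iter_sub // iter_backward1 => e; apply: (np n) => //.
  suff -> : iter n f Q = O by [].
  apply: (@sub_inj (R 1)) => //; first exact: iter_stable.
  by rewrite e sub0.
Qed.

(** After transport to [O], the iterate of [R n - v] at height [m + 1] is the [w] of
    [torsion_divisible], and [R m - u] is killed by [f^m]. From [R m - u = f z] follows
    [u = f (R (m+1) - z)]. *)
Lemma level_divisible m n u v : (m < n)%N ->
  level f V P m u -> level f V P n v -> exists2 z, V z & f z = u.
Proof.
move=> mn lu /level_sub[]; set w := sub (R n) v => Vw wO npw.
have [Vu mu _] := lu; have [_ uO _] := level_sub lu.
have [] := @torsion_divisible m (iter (n - m.+1) f w) _ _ _ (sub (R m) u).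
- exact: iter_stable.
- by rewrite -iterD subnKC.
- rewrite -iterD => e; apply: (npw (m + (n - m.+1))).
    by rewrite -ltnS -addSn subnKC.
  by rewrite e.
- exact: Vsub.
- by [].
move=> z Vz fz; exists (sub (R m.+1) z); first exact: Vsub.
by rewrite fsub // fR fz subK.
Qed.

(** The fibre over [P] is [R 1] minus the kernel; its element [R 1] is periodic and so lies outside
    the tree. *)
Lemma children_root :
  children (preperiodic_tree f V P) P = [set sub (R 1) t; sub (R 1) (op O t)].
Proof.
have fR1 : f (R 1) = P by rewrite fR.
apply/seteqP; split=> [x [nx _ xP fx]|x].
  have Vx : V x by move/(preperiodic_nodesE f x VP): nx => [n []].
  have npx : ~ periodic f x.
    by case: nx => // -[].
  have f0 : f (sub (R 1) x) = O by rewrite fsub // fR1 fx subxx.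
  have xE := subK (VR 1) Vx.
  case: (kerf (Vsub (VR 1) Vx) f0) => e; rewrite e in xE.
  - by case: npx; rewrite -xE sub0.
  - by left.
  - by right.
have child y : V y -> f y = O -> y <> O ->
    children (preperiodic_tree f V P) P (sub (R 1) y).
  move=> Vy fy yO; have l1 : level f V P 1 (sub (R 1) y).
    apply: (@sub_level 1); apply: (level_intro periodicO fO) => //.
  split=> //.
  - by apply/preperiodic_nodesE => //; exists 1.
  - by left.
  - by move=> e; have [_ _ /(_ 0 isT)] := l1; rewrite /= e.
  - by have [] := l1.
case=> ->; apply: child => //; first exact: VN.
by move=> e; apply: tO; rewrite -(opK VO Vt) e.
Qed.

(** A preimage of a non-periodic point is non-periodic, so the tree contains the whole fibre. *)
Lemma children_nonroot v :
  preperiodic_nodes f V P v -> v <> P ->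
  children (preperiodic_tree f V P) v = [set x | V x /\ f x = v].
Proof.
move=> nv vP; apply/seteqP; split=> x.
  by move=> [/(preperiodic_nodesE f x VP)[n [Vx _ _]] _ _ fx].
move=> [Vx fx]; case: (nv) => // -[Vv npv [n [nv' np]]].
have npx : ~ periodic f x.
  by move=> px; apply: npv; rewrite -fx; exact: (periodic_iter 1 px).
split=> //; last by move=> xP; apply: npx; rewrite xP.
right; split=> //; exists n.+1; split; first by rewrite iterSr fx.
by case=> [|i] // lin; rewrite iterSr fx; apply: np.
Qed.

Lemma preperiodic_tree_complete :
  complete_ternary_on_cycle (preperiodic_tree f V P).
Proof.
have rootc : (children (preperiodic_tree f V P) P #= `I_2)%card.
  rewrite children_root; apply: card_eq_set2 => e; apply: NtNt.
  by apply/esym; apply: (@sub_inj (R 1)) => //; exact: VN.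
have nonrootc v : preperiodic_nodes f V P v -> v <> P ->
    children (preperiodic_tree f V P) v = set0 \/
    (children (preperiodic_tree f V P) v #= `I_3)%card.
  move=> nv vP; rewrite children_nonroot //.
  have [[q [Vq <-]]|none] := pselect (exists q, V q /\ f q = v).
    by right; apply: fibre_card3.
  by left; apply/seteqP; split=> // x [Vx fx]; case: none; exists x.
have rootN0 : children (preperiodic_tree f V P) P <> set0.
  rewrite children_root => c0.
  by suff : (set0 : set T) (sub (R 1) t) by []; rewrite -c0; left.
have leaf_le u v m n : leaf (preperiodic_tree f V P) u ->
    leaf (preperiodic_tree f V P) v ->
    has_depth (preperiodic_tree f V P) u m ->
    has_depth (preperiodic_tree f V P) v n -> (n <= m)%N.
  move=> [nu cu] [nv _].
  have [mu lu] := (preperiodic_nodesE f u VP).1 nu.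
  have [nv' lv] := (preperiodic_nodesE f v VP).1 nv.
  move=> /(preperiodic_depth Vf VP pP lu)-> /(preperiodic_depth Vf VP pP lv)->.
  (* If [m < n], then [u] has a preimage by [level_divisible]. This is a child unless [u] is the
     root, which has two children anyway; so [u] is no leaf. *)
  rewrite leqNgt; apply/negP => mn.
  have [z Vz fz] := level_divisible mn lu lv.
  have [uP|uP] := pselect (u = P); first by apply: rootN0; rewrite -{2}uP.
  rewrite children_nonroot // in cu.
  by suff : (set0 : set T) z by []; rewrite -cu.
split; last first.
  move=> u v m n lu lv du dv; apply/eqP; rewrite eqn_leq.
  by rewrite (leaf_le v u n m) // (leaf_le u v m n).
split=> //; split; first exact: preperiodic_arborescence.
move=> v nv; have [->|vP] := pselect (v = P).
  by move: rootc; rewrite card_eq_le => /andP[le _];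
     apply: card_le_trans le _; rewrite card_le_II.
case: (nonrootc v nv vP) => [->|]; first exact: card_ge0.
by rewrite card_eq_le => /andP[].
Qed.

Lemma preperiodic_tree_iso :
  tree_isomorphic (preperiodic_tree f V P) (preperiodic_tree f V O).
Proof.
(* The height of [Q], unique by [level_uniq]; the default [0] is taken only off the tree. *)
pose h Q := xget 0 [set n | level f V P n Q].
pose phi Q := sub (R (h Q)) Q.
have phiE n Q : level f V P n Q -> phi Q = sub (R n) Q.
  move=> lQ; rewrite /phi /h; case: xgetP => [m _ lmQ|/(_ n)] //.
  by have [->] := level_uniq pP pP lQ lmQ.
have phiP : phi P = O.
  by rewrite (@phiE 0) ?R0 ?subxx //; split.
have inj : {in preperiodic_nodes f V P &, injective phi}.
  move=> u v /set_mem/(preperiodic_nodesE f u VP)[m lu].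
  move=> /set_mem/(preperiodic_nodesE f v VP)[n lv].
  rewrite (phiE _ _ lu) (phiE _ _ lv) => e.
  have [Vu _ _] := lu; have [Vv _ _] := lv.
  have lu' := level_sub lu; have := level_sub lv; rewrite -e => lv'.
  have [mn _] := level_uniq periodicO periodicO lu' lv'.
  by apply: (@sub_inj (R m)); rewrite // mn -e mn.
(* [phi] commutes with [f] because [f] lowers the height by one and maps [R (n+1)] to [R n]. *)
have fphi u : preperiodic_nodes f V P u -> u <> P ->
    preperiodic_nodes f V P (f u) /\ f (phi u) = phi (f u).
  move=> /(preperiodic_nodesE f u VP)[[|n] lu] uP.
    by case: uP; have [_ ] := lu.
  have [Vu _ _] := lu; have lfu := levelS lu (Vf Vu).
  split; first by apply/preperiodic_nodesE => //; exists n.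
  by rewrite (phiE _ _ lu) (phiE _ _ lfu) fsub // fR.
have nphi u : preperiodic_nodes f V P u -> preperiodic_nodes f V O (phi u).
  move=> /(preperiodic_nodesE f u VP)[n lu]; apply/preperiodic_nodesE => //.
  by exists n; rewrite (phiE _ _ lu); apply: level_sub.
exists phi; split=> //; first split=> //.
  move=> Q /(preperiodic_nodesE f Q VO)[n lQ].
  have lQ' := sub_level lQ; have [VQ _ _] := lQ.
  exists (sub (R n) Q); last by rewrite (phiE _ _ lQ') subK.
  by apply/preperiodic_nodesE => //; exists n.
move=> u v nu nv; split=> [[_ _ uP fu]|[_ _ uO fu]].
- have [_ fphiu] := fphi u nu uP; rewrite fu in fphiu.
  split=> //; [exact: nphi|exact: nphi|].
  move=> uO; apply: uP; apply: inj; rewrite ?phiP //; apply: mem_set => //.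
  by left.
- have uP : u <> P by move=> uP; apply: uO; rewrite uP.
  have [nfu fphiu] := fphi u nu uP; split=> //.
  by apply: inj; [apply: mem_set|apply: mem_set|rewrite -fphiu].
Qed.

End BackwardOrbit.

Lemma finite_component_structure C : component f V C -> finite_set C ->
  [/\ is_cycle f (C `&` periodic f),
      C = \bigcup_(P in C `&` periodic f) nodes (preperiodic_tree f V P),
      trivIset (C `&` periodic f) (fun P => nodes (preperiodic_tree f V P)) &
      forall P, C P -> periodic f P ->
        complete_ternary_on_cycle (preperiodic_tree f V P) /\
        tree_isomorphic (preperiodic_tree f V P) (preperiodic_tree f V O)].
Proof.
move=> cC finC; have CV : C `<=` V.
  by move=> P /(component_connected cC)[].
split; [exact: (component_cycle Vf)|exact: (component_cover Vf)|
        exact: preperiodic_trees_disjoint|].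
move=> P /CV VP pP; have [R [R0 RP]] := periodic_backward_orbit VP pP.
have VR n : V (R n) by have [] := RP n.
have pR n : periodic f (R n) by have [] := RP n.
have fR n : f (R n.+1) = R n by have [] := RP n.
split; first exact: (preperiodic_tree_complete R0 VR pR fR).
exact: (preperiodic_tree_iso R0 VR pR fR).
Qed.

End TotallySymmetricQuasigroup.

Local Open Scope ring_scope.

(** * Chords and tangents of [y^2 = x^3 + a], and the 3-isogeny *)

Section CollinearPoints.
Variables (F : fieldType) (a : F).
Hypotheses (two_neq0 : 2 != 0 :> F) (three_neq0 : 3 != 0 :> F).
Hypothesis a_neq0 : a != 0.
Implicit Types P Q R : option (F * F).

Definition weierstrass P : Prop :=
  if P is Some (x, y) then y ^+ 2 = x ^+ 3 + a else True.

(* [P], [Q], [R] are the intersections, with multiplicity, of the curve and a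
   line: comparing coefficients,
   X^3 + a - (l X + n)^2 = (X - x1) (X - x2) (X - x3) for a line Y = l X + n. *)
Definition collinear P Q R : Prop :=
  match P, Q, R with
  | Some (x1, y1), Some (x2, y2), Some (x3, y3) => exists l n,
      [/\ y1 = l * x1 + n, y2 = l * x2 + n & y3 = l * x3 + n] /\
      [/\ x1 + x2 + x3 = l ^+ 2,
          x1 * x2 + x1 * x3 + x2 * x3 = - (2 * l * n) &
          x1 * x2 * x3 = n ^+ 2 - a]
  | None, Some (x, y), Some (x', y') | Some (x, y), None, Some (x', y')
  | Some (x, y), Some (x', y'), None => x = x' /\ y = - y'
  | None, None, None => True
  | _, _, _ => False
  end.

Lemma collinearC P Q R : collinear P Q R -> collinear Q P R.
Proof.
case: P Q R => [[x1 y1]|] [[x2 y2]|] [[x3 y3]|] //=.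
  move=> [l [n [[e1 e2 e3] [s1 s2 s3]]]]; exists l, n; split=> //; split.
  - by rewrite -s1; ring.
  - by rewrite -s2; ring.
  - by rewrite -s3; ring.
by move=> [-> ->]; rewrite opprK.
Qed.

Lemma collinearCr P Q R : collinear P Q R -> collinear P R Q.
Proof.
case: P Q R => [[x1 y1]|] [[x2 y2]|] [[x3 y3]|] //=.
  move=> [l [n [[e1 e2 e3] [s1 s2 s3]]]]; exists l, n; split=> //; split.
  - by rewrite -s1; ring.
  - by rewrite -s2; ring.
  - by rewrite -s3; ring.
by move=> [-> ->]; rewrite opprK.
Qed.

(** The derivative of [X^3 + a - (l X + n)^2] vanishes at the double root [x]. *)
Let tangent_slope (l n x z : F) :
  x + x + z = l ^+ 2 -> x * x + x * z + x * z = - (2 * l * n) ->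
  3 * x ^+ 2 = 2 * l * (l * x + n).
Proof.
move=> s1 s2.
have -> : 2 * l * (l * x + n) = 2 * l ^+ 2 * x - - (2 * l * n) by ring.
by rewrite -s1 -s2; ring.
Qed.

(** Opposite points on a line [Y = l X + n] coincide, with [y1 = 0]. The line is then tangent there,
    which forces [x1 = 0] and [a = 0]. *)
Lemma not_vertical x1 y1 x2 y2 x3 y3 : weierstrass (Some (x1, y1)) ->
  collinear (Some (x1, y1)) (Some (x2, y2)) (Some (x3, y3)) ->
  ~ (x1 = x2 /\ y1 = - y2).
Proof.
move=> /= w1 [l [n [[e1 e2 _] [s1 s2 s3]]]] [xx yy]; rewrite -xx in e2 s1 s2.
have y10 : y1 = 0.
  have /eqP : 2 * y1 = 0.
    by rewrite {1}(_ : 2 = 1 + 1) // mulrDl mul1r {1}yy e1 e2 addNr.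
  by rewrite mulf_eq0 (negPf two_neq0) => /eqP.
have /eqP : 3 * x1 ^+ 2 = 0.
  have -> : 3 * x1 ^+ 2 = 2 * l * y1 by rewrite e1; apply: tangent_slope s1 s2.
  by rewrite y10 mulr0.
rewrite mulf_eq0 (negPf three_neq0) sqrf_eq0 => /eqP x10.
by move/eqP: w1; rewrite x10 y10 !expr0n /= add0r eq_sym (negPf a_neq0).
Qed.

(** Two affine, non-opposite points determine the slope, as a chord or as a tangent; then
    [x1 + x2 + x3 = l^2] gives the third point. *)
Lemma collinear_uniq P Q R R' : weierstrass P -> weierstrass Q ->
  collinear P Q R -> collinear P Q R' -> R = R'.
Proof.
case: P Q => [[x1 y1]|] [[x2 y2]|] wP wQ;
  case: R R' => [[x3 y3]|] [[x3' y3']|] //.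
- move=> cR; have nv := not_vertical wP cR.
  move: cR => [l [n [[e1 e2 e3] [s1 s2 s3]]]].
  move=> [l' [n' [[e1' e2' e3'] [s1' s2' s3']]]].
  have ll : l = l'.
    have [xx|/eqP xx] := pselect (x1 = x2); last first.
      rewrite -subr_eq0 in xx.
      apply: (mulIf xx); transitivity (y1 - y2); first by rewrite e1 e2; ring.
      by rewrite e1' e2'; ring.
    have yy : y1 = y2 by rewrite e1 e2 xx.
    rewrite -xx in e2 e2' s1 s1' s2 s2'.
    have y10 : 2 * y1 != 0.
      rewrite mulf_neq0 //; apply/eqP => y10.
      by case: nv; rewrite -yy y10 oppr0.
    apply: (mulIf y10); rewrite !(mulrCA _ 2) !mulrA.
    transitivity (3 * x1 ^+ 2).
      by rewrite e1 -(tangent_slope s1 s2).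
    by rewrite e1'; apply: tangent_slope s1' s2'.
  subst l'.
  have nn : n = n' by apply: (addrI (l * x1)); rewrite -e1 -e1'.
  subst n'.
  have xx : x3 = x3' by apply: (addrI (x1 + x2)); rewrite s1 s1'.
  by rewrite e3 e3' xx.
- by move=> /(not_vertical wP) nv /nv.
- by move=> + /(not_vertical wP).
- by move=> /= [<- e] [<- e']; rewrite -[y3]opprK -e e' opprK.
- by move=> /= [<- e] [<- e']; rewrite -[y3]opprK -e e' opprK.
Qed.

Definition points (S : {pred F}) : set (option (F * F)) :=
  [set P | weierstrass P /\
           if P is Some (x, y) then x \in S /\ y \in S else True].

(** The slope of the chord or tangent lies in [S], hence so does the third point; vertical lines
    meet the curve again at [None] or at an opposite point. *)
Lemma collinear_exists (S : {pred F}) P Q : GRing.divring_closed S ->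
  points S P -> points S Q -> exists2 R, points S R & collinear P Q R.
Proof.
move=> divS; have [S1 SB SV] := divS.
have SN : {in S, forall x, - x \in S} := GRing.zmod_closedN divS.
have [_ SD] := GRing.zmod_closedD divS.
have [_ SM] := GRing.subring_closedM divS.
have vertical x y : points S (Some (x, y)) -> points S (Some (x, - y)).
  by move=> [/= w [Sx Sy]]; split; rewrite /= ?sqrrN //; split=> //;
     rewrite SN.
have chord x1 y1 x2 y2 l n :
    points S (Some (x1, y1)) -> points S (Some (x2, y2)) -> l \in S ->
    y1 = l * x1 + n -> y2 = l * x2 + n ->
    x1 * x2 + (x1 + x2) * (l ^+ 2 - x1 - x2) = - (2 * l * n) ->
    exists2 R, points S R & collinear (Some (x1, y1)) (Some (x2, y2)) R.
  move=> [w1 [Sx1 Sy1]] [w2 [Sx2 Sy2]] Sl e1 e2 s2.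
  pose x3 := l ^+ 2 - x1 - x2.
  have s2' : x1 * x2 + x1 * x3 + x2 * x3 = - (2 * l * n).
    by rewrite -s2 /x3; ring.
  (* The two cubics agree in degrees 1 and 2 and both vanish at [x1], so their constant terms
     agree. *)
  have s3 : x1 * x2 * x3 = n ^+ 2 - a.
    have -> : a = (l * x1 + n) ^+ 2 - x1 ^+ 3 by rewrite -e1 w1; ring.
    have -> : n ^+ 2 - ((l * x1 + n) ^+ 2 - x1 ^+ 3) =
      x1 ^+ 3 - l ^+ 2 * x1 ^+ 2 - 2 * l * n * x1 by ring.
    by rewrite -[2 * l * n]opprK -s2' /x3; ring.
  have Sn : n \in S.
    have -> : n = y1 - l * x1 by rewrite e1; ring.
    by rewrite SB ?SM.
  have Sx3 : x3 \in S by rewrite !SB ?SM.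
  exists (Some (x3, l * x3 + n)); last first.
    by exists l, n; split; split=> //; rewrite /x3; ring.
  split; last by split=> //; rewrite SD ?SM.
  rewrite /=.
  have -> : a = n ^+ 2 - x1 * x2 * x3 by rewrite s3; ring.
  have -> : x3 ^+ 3 + (n ^+ 2 - x1 * x2 * x3) = (l * x3 + n) ^+ 2
     + (x3 ^+ 3 - l ^+ 2 * x3 ^+ 2 - 2 * l * n * x3 - x1 * x2 * x3) by ring.
  by rewrite -[2 * l * n]opprK -s2' /x3; ring.
case: P Q => [[x1 y1]|] [[x2 y2]|] SP SQ.
- have [xx|xx] := pselect (x1 = x2); last first.
    have x120 : x2 - x1 != 0 by rewrite subr_eq0; apply/eqP => /esym.
    have [[w1 [Sx1 Sy1]] [w2 [Sx2 Sy2]]] := (SP, SQ).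
    apply: (@chord _ _ _ _ ((y2 - y1) / (x2 - x1))
      (y1 - (y2 - y1) / (x2 - x1) * x1)) => //.
    + by rewrite SV ?SB.
    + by ring.
    + by field.
    + by rewrite /= in w1 w2; field: w1 w2.
  subst x2.
  have [w1 [Sx1 Sy1]] := SP; have [w2 [Sx2 Sy2]] := SQ.
  have /eqP := w1; rewrite -w2 eqf_sqr => /orP[] /eqP yy; last first.
    by exists None => //=; split.
  subst y2; have [y10|/eqP y10] := pselect (y1 = 0).
    by exists None => //=; rewrite y10 oppr0.
  apply: (@chord _ _ _ _ (3 * x1 ^+ 2 / (2 * y1))
      (y1 - (3 * x1 ^+ 2 / (2 * y1)) * x1)) => //.
  + by rewrite SV ?SM ?SD.
  + by ring.
  + by ring.
  + by field; rewrite y10 two_neq0.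
- by case: SP => w1 [Sx1 Sy1]; exists (Some (x1, - y1));
    [exact: vertical|rewrite /= opprK].
- by case: SQ => w1 [Sx1 Sy1]; exists (Some (x2, - y2));
    [exact: vertical|rewrite /= opprK].
- by exists None.
Qed.

(** This is [psi] written with [k = 4 a]; on the curve the kernel is detected by [x = 0] alone. *)
Definition isogeny (s : F) P : option (F * F) :=
  if P is Some (x, y) then
    if x == 0 then None
    else Some (- ((x ^+ 3 + 4 * a) / (3 * x ^+ 2)),
               - y * ((x ^+ 3 - 8 * a) / (3 * s * x ^+ 3)))
  else None.

Variable s : F.
Hypothesis s_sqr : s ^+ 2 = - 3.

Let s_neq0 : s != 0.
Proof.
by apply/eqP => s0; move/eqP: s_sqr; rewrite s0 expr0n /= eq_sym oppr_eq0;
   apply/negP.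
Qed.

Let nine_neq0 : 9 != 0 :> F.
Proof. by rewrite -[9]/((3 * 3)%:R) natrM mulf_neq0. Qed.

Let n27_neq0 : 27 != 0 :> F.
Proof. by rewrite -[27]/((9 * 3)%:R) natrM mulf_neq0. Qed.

(* The image line is cut out by the norm of Y - l X - n along the isogeny; it is
   vertical exactly when n^2 = a, that is, when some x_i vanishes. *)
Lemma isogeny_generic x1 y1 x2 y2 x3 y3 : x1 != 0 -> x2 != 0 -> x3 != 0 ->
  collinear (Some (x1, y1)) (Some (x2, y2)) (Some (x3, y3)) ->
  collinear (isogeny s (Some (x1, y1))) (isogeny s (Some (x2, y2)))
            (isogeny s (Some (x3, y3))).
Proof.
move=> x10 x20 x30 [l [n [[-> -> ->] [e1 e2 e3]]]].
rewrite /= (negPf x10) (negPf x20) (negPf x30).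
have D0 : n ^+ 2 - a != 0 by rewrite -e3 !mulf_neq0.
have onl x : x ^+ 3 - (x1 + x2 + x3) * x ^+ 2 +
    (x1 * x2 + x1 * x3 + x2 * x3) * x - x1 * x2 * x3 = 0 ->
    a = (l * x + n) ^+ 2 - x ^+ 3.
  rewrite e1 e2 e3 => /eqP; rewrite addr_eq0 => /eqP e.
  suff -> : a = n ^+ 2 - (n ^+ 2 - a) by rewrite -[n ^+ 2 - a]opprK -e; ring.
  by ring.
have image x : x != 0 -> a = (l * x + n) ^+ 2 - x ^+ 3 ->
   - (l * x + n) * ((x ^+ 3 - 8 * a) / (3 * s * x ^+ 3)) =
   l * (n ^+ 2 + 3 * a) / (s * (n ^+ 2 - a)) *
     - ((x ^+ 3 + 4 * a) / (3 * x ^+ 2)) +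
   (4 * a * l ^+ 3 - n * (n ^+ 2 - 9 * a)) / (3 * s * (n ^+ 2 - a)).
  move=> x0 aE; move: D0; rewrite aE => D0.
  by field; rewrite x0 s_neq0 D0 three_neq0.
exists (l * (n ^+ 2 + 3 * a) / (s * (n ^+ 2 - a))).
exists ((4 * a * l ^+ 3 - n * (n ^+ 2 - 9 * a)) / (3 * s * (n ^+ 2 - a))).
split; first by split; apply: image => //; apply: onl; ring.
have E3 : (x1 * x2 * x3) != 0 by rewrite e3.
split.
(* Each symmetric function of the image abscissas is written in the elementary symmetric functions
   of the [x_i]. Replacing these by [l], [n] and [a] leaves an identity modulo [s^2 = -3]. *)
- transitivity (- (((x1 + x2 + x3) + 4 * a *
    ((x1 * x2 + x1 * x3 + x2 * x3) ^+ 2 - 2 * (x1 + x2 + x3) * (x1 * x2 * x3))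
    / (x1 * x2 * x3) ^+ 2) / 3)).
    by field; rewrite x10 x20 x30 ?three_neq0 ?nine_neq0 ?n27_neq0.
  rewrite e1 e2 e3; field: s_sqr.
  by rewrite s_neq0 D0 ?three_neq0 ?nine_neq0 ?n27_neq0.
- transitivity (((x1 * x2 + x1 * x3 + x2 * x3)
    + (4 * a * ((x1 + x2 + x3) * (x1 * x2 + x1 * x3 + x2 * x3) ^+ 2
        - 2 * (x1 + x2 + x3) ^+ 2 * (x1 * x2 * x3)
        - (x1 * x2 + x1 * x3 + x2 * x3) * (x1 * x2 * x3))
    + 16 * a ^+ 2 * ((x1 + x2 + x3) ^+ 2
        - 2 * (x1 * x2 + x1 * x3 + x2 * x3))) / (x1 * x2 * x3) ^+ 2) / 9).
    by field; rewrite x10 x20 x30 ?three_neq0 ?nine_neq0 ?n27_neq0.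
  rewrite e1 e2 e3; field: s_sqr.
  by rewrite s_neq0 D0 ?three_neq0 ?nine_neq0 ?n27_neq0.
- transitivity (- (((x1 * x2 * x3)
    + (4 * a * ((x1 * x2 + x1 * x3 + x2 * x3) ^+ 3
        - 3 * (x1 + x2 + x3) * (x1 * x2 + x1 * x3 + x2 * x3) * (x1 * x2 * x3)
        + 3 * (x1 * x2 * x3) ^+ 2)
    + 16 * a ^+ 2 * ((x1 + x2 + x3) ^+ 3
        - 3 * (x1 + x2 + x3) * (x1 * x2 + x1 * x3 + x2 * x3)
        + 3 * (x1 * x2 * x3))
    + 64 * a ^+ 3) / (x1 * x2 * x3) ^+ 2) / 27)).
    by field; rewrite x10 x20 x30 ?three_neq0 ?nine_neq0 ?n27_neq0.
  rewrite e1 e2 e3; field: s_sqr.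
  by rewrite s_neq0 D0 ?three_neq0 ?nine_neq0 ?n27_neq0.
Qed.

Lemma isogeny_kernel_collinear y1 x2 y2 x3 y3 :
  collinear (Some (0, y1)) (Some (x2, y2)) (Some (x3, y3)) ->
  collinear None (isogeny s (Some (x2, y2))) (isogeny s (Some (x3, y3))).
Proof.
move=> [l [n [[_ -> ->] [/esym e1 e2 /esym/eqP e3]]]].
rewrite !mul0r !add0r in e1 e2 e3; rewrite subr_eq0 in e3.
move/eqP: e3 => na.
have n0 : n != 0 by apply: contraNneq a_neq0 => n0; rewrite -na n0 expr0n.
(* The line [Y = n] with [n^2 = a] is an inflection tangent: all three points are [(0, n)]. *)
have [l0|l0] := eqVneq l 0.
  have x32 : x3 = - x2.
    by apply/eqP; rewrite -addr_eq0 addrC -e1 l0 expr0n.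
  move/eqP: e2; rewrite x32 l0 mulr0 mul0r oppr0 mulrN oppr_eq0 mulf_eq0 orbb.
  by move=> /eqP->; rewrite /= oppr0 eqxx.
have x20 : x2 != 0.
  apply/eqP => x20; move/eqP: e2; rewrite x20 mul0r eq_sym oppr_eq0.
  by rewrite !mulf_eq0 (negPf two_neq0) (negPf l0) (negPf n0).
have x30 : x3 != 0.
  apply/eqP => x30; move/eqP: e2; rewrite x30 mulr0 eq_sym oppr_eq0.
  by rewrite !mulf_eq0 (negPf two_neq0) (negPf l0) (negPf n0).
rewrite /= (negPf x20) (negPf x30) -na.
(* With [a = n^2], everything is expressed by [l], [x2] and [s], which leaves identities of rational
   functions. *)
have nE : n = - (x2 * x3) / (2 * l) by rewrite e2; field; rewrite l0 two_neq0.
have x3E : x3 = l ^+ 2 - x2 by rewrite e1; ring.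
rewrite nE; move: x30; rewrite x3E => x30.
by split; field; rewrite x30 x20 l0 two_neq0 three_neq0 ?s_neq0.
Qed.

Lemma isogeny_opp Q R :
  collinear None Q R -> collinear None (isogeny s Q) (isogeny s R).
Proof.
case: Q R => [[x y]|] [[x' y']|] //= [<- ->].
by case: eqP => // _; split=> //; rewrite opprK mulNr opprK.
Qed.

Lemma isogeny_collinear P Q R : collinear P Q R ->
  collinear (isogeny s P) (isogeny s Q) (isogeny s R).
Proof.
case: P => [[x1 y1]|]; last exact: isogeny_opp.
case: Q => [[x2 y2]|]; last by move=> /collinearC/isogeny_opp/collinearC.
case: R => [[x3 y3]|]; last first.
  by move=> /collinearCr/collinearC/isogeny_opp/collinearC/collinearCr.
have kernel y : isogeny s (Some (0, y)) = None by rewrite /= eqxx.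
have [->|x10] := eqVneq x1 0.
  by move=> /isogeny_kernel_collinear; rewrite kernel.
have [->|x20] := eqVneq x2 0.
  by move=> /collinearC/isogeny_kernel_collinear/collinearC; rewrite kernel.
have [->|x30] := eqVneq x3 0.
  move=> /collinearCr/collinearC/isogeny_kernel_collinear.
  by move=> /collinearC/collinearCr; rewrite kernel.
exact: isogeny_generic.
Qed.

(** * Points over a subfield containing [s] and a square root of [a] *)

Section RationalPoints.
Variables (S : {pred F}) (c : F).
Hypotheses (divS : GRing.divring_closed S) (Ss : s \in S) (Sc : c \in S).
Hypothesis c_sqr : c ^+ 2 = a.

Let c_neq0 : c != 0.
Proof. by apply: contraNneq a_neq0 => c0; rewrite -c_sqr c0 expr0n. Qed.

Lemma isogeny_stable P : points S P -> points S (isogeny s P).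
Proof.
have [S1 SB SV] := divS.
have SN : {in S, forall x, - x \in S} := GRing.zmod_closedN divS.
have [_ SD] := GRing.zmod_closedD divS.
have [_ SM] := GRing.subring_closedM divS.
have SX x n : x \in S -> x ^+ n \in S.
  by move=> Sx; elim: n => [|n IH]; rewrite ?expr0 // exprS SM.
have Sn n : n%:R \in S.
  by elim: n => [|n IH]; rewrite ?(GRing.zmod_closedD divS).1 // mulrS SD.
case: P => [[x y]|] //= [w [Sx Sy]]; case: eqP => [//|/eqP x0].
rewrite /= in w; split.
  by rewrite /=; field: w s_sqr; rewrite x0 s_neq0 three_neq0.
by rewrite -c_sqr; split; rewrite ?(SN, SV, SM, SB, SD, SX, Sn).
Qed.

Lemma isogeny_kernel P : points S P -> isogeny s P = None ->
  [\/ P = None, P = Some (0, c) | P = Some (0, - c)].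
Proof.
case: P => [[x y] [/= w _]|]; last by constructor 1.
case: eqP => // x0 _; move/eqP: w; rewrite x0 expr0n /= add0r -c_sqr eqf_sqr.
by case/orP=> /eqP ->; [constructor 2|constructor 3].
Qed.

(** Agreement of [f] with [isogeny] is asked on the curve only, since [psi] tests both coordinates
    for the kernel. *)
Lemma isogeny_finite_component (f : option (F * F) -> option (F * F)) C :
  (forall P, points S P -> f P = isogeny s P) ->
  let V := points S in let tau := preperiodic_tree f V in
  component f V C -> finite_set C ->
  [/\ is_cycle f (C `&` periodic f),
      C = \bigcup_(P in C `&` periodic f) nodes (tau P),
      trivIset (C `&` periodic f) (fun P => nodes (tau P)) &
      forall P, C P -> periodic f P ->
        complete_ternary_on_cycle (tau P) /\
        tree_isomorphic (tau P) (tau None)].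
Proof.
move=> fE /= cC finC.
(* By [collinear_exists], the default is never reached for arguments in [points S]. *)
pose op P Q := xget None [set R | points S R /\ collinear P Q R].
have opP P Q : points S P -> points S Q ->
    points S (op P Q) /\ collinear P Q (op P Q).
  move=> VP VQ; rewrite /op; case: xgetP => // none.
  by have [R VR cR] := collinear_exists divS VP VQ; case: (none R).
have opE P Q R : points S P -> points S Q -> collinear P Q R -> op P Q = R.
  move=> VP VQ; have [_ cop] := opP P Q VP VQ.
  by apply: collinear_uniq cop; [case: VP|case: VQ].
have SN : {in S, forall x, - x \in S} := GRing.zmod_closedN divS.
have S0 : 0 \in S := (GRing.zmod_closedD divS).1.
have VO : points S None by [].
have Vt : points S (Some (0, c)) by split; rewrite //= expr0n add0r.
have VNt : points S (Some (0, - c)).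
  by split; rewrite /= ?sqrrN ?expr0n ?add0r //; split=> //; exact: SN.
have Nt : op None (Some (0, c)) = Some (0, - c).
  by apply: opE; rewrite //= opprK.
apply: (@finite_component_structure _ f (points S) op None (Some (0, c))) => //.
- by move=> P VP; rewrite fE //; apply: isogeny_stable.
- by move=> P Q VP VQ; have [] := opP P Q VP VQ.
- move=> P Q VP VQ; have [_ cop] := opP Q P VQ VP.
  by apply: opE => //; apply: collinearC.
- move=> P Q VP VQ; have [Vop cop] := opP P Q VP VQ.
  by apply: opE => //; apply: collinearCr.
- move=> P Q VP VQ; have [Vop cop] := opP P Q VP VQ.
  rewrite !fE //; apply/esym/opE; try exact: isogeny_stable.
  exact: isogeny_collinear.
- exact: opE.
- by rewrite fE.
- by rewrite fE //= eqxx.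
- rewrite Nt => -[/eqP]; rewrite eq_sym -addr_eq0 -mulr2n -mulr_natl mulf_eq0.
  by rewrite (negPf two_neq0) (negPf c_neq0).
- by move=> P VP; rewrite Nt fE //; apply: isogeny_kernel.
Qed.

End RationalPoints.
End CollinearPoints.

(** * The field [L] contains the square roots of [k] and of [-3] *)

Lemma pchar_nat_neq0 (R : nzRingType) p : prime p -> p \notin [pchar R] ->
  p%:R != 0 :> R.
Proof. by move=> p_pr; apply: contraNneq => p0; rewrite inE p_pr p0 eqxx. Qed.

Lemma closed_sqrt (F : closedFieldType) (z : F) : exists w, w ^+ 2 = z.
Proof.
have [w wE] := @GRing.solve_monicpoly F 2 (nth 0 [:: z]) isT.
by exists w; rewrite wE big_ord_recr big_ord1 /= expr0 mulr1 mul0r addr0.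
Qed.

Section FieldL.
Variables (K : fieldType) (Kbar : closedFieldType).
Variables (iota : {rmorphism K -> Kbar}) (k : K).
Hypotheses (char_neq2 : 2%N \notin [pchar K])
  (char_neq3 : 3%N \notin [pchar K]).
Variables (s3 sk : Kbar).
Hypotheses (s3_sqr : s3 ^+ 2 = -3) (sk_sqr : sk ^+ 2 = iota k).

Notation L := (fieldL iota k).

Let two_neq0 : 2 != 0 :> K. Proof. exact: pchar_nat_neq0. Qed.
Let three_neq0 : 3 != 0 :> K. Proof. exact: pchar_nat_neq0. Qed.
Let four_neq0 : 4 != 0 :> K.
Proof. by rewrite -[4]/((2 * 2)%:R) natrM mulf_neq0. Qed.
Let iota_nat_neq0 n : n%:R != 0 :> K -> n%:R != 0 :> Kbar.
Proof. by rewrite -(rmorph_nat iota) fmorph_eq0. Qed.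

Lemma fieldL_divring : GRing.divring_closed (mem L).
Proof.
split.
- by apply: mem_set => M [[M1 _ _] _]; apply/set_mem.
- move=> x y /set_mem Lx /set_mem Ly; apply: mem_set => M MP.
  have [[_ MB _] _] := MP; apply/set_mem/MB; apply: mem_set.
    exact: Lx.
  exact: Ly.
- move=> x y /set_mem Lx /set_mem Ly; apply: mem_set => M MP.
  have [[_ _ MV] _] := MP; apply/set_mem/MV; apply: mem_set.
    exact: Lx.
  exact: Ly.
Qed.

Lemma fieldL_iota x : iota x \in mem L.
Proof. by apply: mem_set => M [_]; apply; left; exists x. Qed.

Lemma fieldL_sqrt x z : z ^+ 2 = iota (x ^+ 3 + k / 4) -> z \in mem L.
Proof. by move=> zx; apply: mem_set => M [_]; apply; right; exists x. Qed.

Let LV : GRing.divr_2closed (mem L). Proof. by have [] := fieldL_divring. Qed.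
Let LM : GRing.mulr_2closed (mem L).
Proof. by have [_] := GRing.subring_closedM fieldL_divring. Qed.
Let LN : {in mem L, forall z, - z \in mem L}.
Proof. exact: (GRing.zmod_closedN fieldL_divring). Qed.

Lemma fieldL_sqrt_k : sk / 2 \in mem L.
Proof.
apply: (@fieldL_sqrt 0).
by rewrite expr0n add0r fmorph_div rmorph_nat -sk_sqr expr_div_n -natrX.
Qed.

(* For x in K generic, g(X) = X^3 + k/4 satisfies
   -27 x^6 g(- (x^3 + k) / (3 x^2)) = (x^3 - 2k)^2 g(x),
   so that -3 is a square in L. *)
Let sqrt_m3_of_generic x :
  x != 0 -> x ^+ 3 + k / 4 != 0 -> x ^+ 3 - 2 * k != 0 -> s3 \in mem L.
Proof.
move=> x0 gx0 hx0; pose x' := - ((x ^+ 3 + k) / (3 * x ^+ 2)).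
have [z zE] := closed_sqrt (iota (x ^+ 3 + k / 4)).
have [z' z'E] := closed_sqrt (iota (x' ^+ 3 + k / 4)).
have Lz : z \in mem L by exact: fieldL_sqrt zE.
have Lz' : z' \in mem L by exact: fieldL_sqrt z'E.
have gx' : - 27 * x ^+ 6 * (x' ^+ 3 + k / 4)
           = (x ^+ 3 - 2 * k) ^+ 2 * (x ^+ 3 + k / 4).
  by rewrite /x'; field; rewrite x0 three_neq0 four_neq0.
have z'0 : z' != 0.
  apply/eqP => z'0; move/esym/eqP: z'E.
  rewrite z'0 expr0n /= fmorph_eq0 => /eqP g0; move/esym/eqP: gx'.
  by rewrite g0 mulr0 mulf_eq0 sqrf_eq0 (negPf hx0) (negPf gx0).
pose u := iota (x ^+ 3 - 2 * k) * z; pose v := iota (3 * x ^+ 3) * z'.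
have v0 : v != 0 by rewrite mulf_neq0 // fmorph_eq0 mulf_neq0 ?expf_neq0.
have Lu : u \in mem L by apply: LM => //; apply: fieldL_iota.
have Lv : v \in mem L by apply: LM => //; apply: fieldL_iota.
(* Since [u] and [v] lie in [L], this gives [s3 = u / v] up to sign. *)
have /eqP : (s3 * v) ^+ 2 = u ^+ 2.
  rewrite !exprMn s3_sqr zE z'E -!rmorphXn -!rmorphM /= -gx'.
  rewrite -(rmorph_nat iota 3) -rmorphN -rmorphM; congr (iota _); ring.
rewrite eqf_sqr => /orP[] /eqP e; have -> : s3 = (s3 * v) / v by rewrite mulfK.
  by rewrite e; apply: LV.
by rewrite e; apply: LV => //; apply: LN.
Qed.

(** A nonzero [x] in [K] is wanted whose cube is neither [- k / 4] nor [2 k]. The cubes of 1, -1 and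
    2 differ pairwise by 2, 7 and 9, so one of the three will do outside characteristic 7, where
    [-3 = 2^2]. *)
Lemma fieldL_sqrt_m3 : s3 \in mem L.
Proof.
have [seven0|seven0] := eqVneq (7 : K) 0.
  have /eqP : s3 ^+ 2 = 2 ^+ 2.
    rewrite s3_sqr; apply/eqP; rewrite eq_sym -subr_eq0 opprK.
    by rewrite -natrX -natrD -(rmorph_nat iota) seven0 rmorph0.
  have L2 : 2 \in mem L.
    by rewrite -(rmorph_nat iota); apply: fieldL_iota.
  by rewrite eqf_sqr => /orP[] /eqP -> //; apply: LN.
apply: contrapT => notL.
have bad x : x != 0 -> x ^+ 3 = - (k / 4) \/ x ^+ 3 = 2 * k.
  move=> x0; have [|gx0] := eqVneq (x ^+ 3 + k / 4) 0.
    by move/eqP; rewrite addr_eq0 => /eqP; left.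
  have [/eqP|hx0] := eqVneq (x ^+ 3 - 2 * k) 0.
    by rewrite subr_eq0 => /eqP; right.
  by case: notL; apply: sqrt_m3_of_generic gx0 hx0.
have eq_absurd (u v : K) n : u - v = n%:R -> n%:R != 0 :> K -> u <> v.
  by move=> e n0 uv; move: n0; rewrite -e uv subrr eqxx.
have nine0 : 9 != 0 :> K by rewrite -[9]/((3 * 3)%:R) natrM mulf_neq0.
have ne1 : (1 : K) ^+ 3 <> (-1) ^+ 3 by apply: (@eq_absurd _ _ 2) => //; ring.
have ne2 : (2 : K) ^+ 3 <> 1 ^+ 3 by apply: (@eq_absurd _ _ 7) => //; ring.
have ne3 : (2 : K) ^+ 3 <> (-1) ^+ 3 by apply: (@eq_absurd _ _ 9) => //; ring.
have N10 : -1 != 0 :> K by rewrite oppr_eq0 oner_eq0.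
case: (bad 1 (oner_neq0 _)) => e1; case: (bad _ N10) => e2;
  case: (bad 2 two_neq0) => e3;
  solve [by case: ne1; rewrite e1 e2 | by case: ne2; rewrite e1 e3
        |by case: ne3; rewrite e2 e3].
Qed.

Lemma curveLE : curveL iota k = points (iota k / 4) (mem L).
Proof.
apply/seteqP; split=> -[[x y]|] //= [w [Lx Ly]]; split=> //; split;
  by [apply: mem_set|apply: set_mem].
Qed.

(** On the curve, [x = 0] forces [y^2 = k / 4], that is, [y] is [sk / 2] or its opposite. *)
Lemma psiE P :
  curveL iota k P -> psi iota k s3 sk P = isogeny (iota k / 4) s3 P.
Proof.
case: P => [[x y]|] //= [w _]; rewrite !inE.
have eqS u v : (Some (x, y) == Some (u, v)) = (x == u) && (y == v) by [].
rewrite !eqS.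
have -> : (x == 0) && (y == sk / 2) || (x == 0) && (y == - (sk / 2)) = (x == 0).
  rewrite -andb_orr -eqf_sqr; have [x0|//] := eqVneq x 0.
  by rewrite w x0 expr0n add0r -sk_sqr expr_div_n -natrX eqxx.
have four0 := iota_nat_neq0 four_neq0.
have k4 : 4 * (iota k / 4) = iota k by rewrite mulrC divfK.
have k8 : 8 * (iota k / 4) = 2 * iota k.
  by rewrite -[8]/((2 * 4)%:R) natrM -mulrA k4.
by rewrite k4 k8.
Qed.

End FieldL.

Theorem theorem4p9
    (K : fieldType) (Kbar : closedFieldType) (iota : {rmorphism K -> Kbar})
    (Kbar_closure : is_algebraic_closure iota)
    (char_neq2 : 2%N \notin [pchar K]) (char_neq3 : 3%N \notin [pchar K])
    (k : K) (k_neq0 : k != 0)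
    (s3 sk : Kbar) (s3_sqr : s3 ^+ 2 = -3) (sk_sqr : sk ^+ 2 = iota k) :
  let f := psi iota k s3 sk in
  let V := curveL iota k in
  let tau := preperiodic_tree f V in
  forall C : set (ec_point Kbar), component f V C -> finite_set C ->
    [/\ is_cycle f (C `&` periodic f),
        C = \bigcup_(P in C `&` periodic f) nodes (tau P),
        trivIset (C `&` periodic f) (fun P => nodes (tau P)) &
        forall P, C P -> periodic f P ->
          complete_ternary_on_cycle (tau P) /\
          tree_isomorphic (tau P) (tau None)].
Proof.
have two0 : 2 != 0 :> Kbar.
  by rewrite -(rmorph_nat iota) fmorph_eq0 pchar_nat_neq0.
have three0 : 3 != 0 :> Kbar.
  by rewrite -(rmorph_nat iota) fmorph_eq0 pchar_nat_neq0.
have a0 : iota k / 4 != 0.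
  rewrite mulf_neq0 ?fmorph_eq0 // invr_eq0.
  by rewrite -[4]/((2 * 2)%:R) natrM mulf_neq0.
have psiLE P := @psiE _ _ iota k char_neq2 s3 sk sk_sqr P.
rewrite /= curveLE in psiLE *.
move=> C.
apply: (@isogeny_finite_component _ _ two0 three0 a0 _ s3_sqr _ (sk / 2)).
- exact: fieldL_divring.
- exact: fieldL_sqrt_m3.
- exact: fieldL_sqrt_k.
- by rewrite -sk_sqr expr_div_n -natrX.
- exact: psiLE.
Qed.
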